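(* Let $s:E\to i\mathbb R$ be a function on the edges of the hexagonal lattice $HL$, and for $v\in HL$ put $s_k(v)=s(\{v,v+\omega^k\})$, $k$ mod $6$. The general solution $s$ of the system $$s_k(v)+s_{k+2}(v)+s_{k+4}(v)+s_k(v)\,s_{k+1}(v)\,s_{k+2}(v)=0,\qquad s_k(v)=s_{k+3}(v)\qquad\text{for all } v\in HL,\ k\ \mathrm{mod}\ 6,$$ is given by $$a_n=i\tan(\Delta n+\alpha),\qquad b_n=i\tan(\Delta n+\beta),\qquad c_n=i\tan(\Delta n+\gamma),\qquad n\in\mathbb Z,$$ where $\Delta=-\alpha-\beta-\gamma$. That is, $s$ is a solution if and only if there exist $\alpha,\beta,\gamma\in\mathbb R$ such that, with $\Delta=-\alpha-\beta-\gamma$ and with $\tan(\Delta j+\alpha)$, $\tan(\Delta j+\beta)$ and $\tan(\Delta j+\gamma)$ finite for all $j\in\mathbb Z$, for all $n,m\in\mathbb Z$ and $v=n+m\omega$, $$s(\{v,v+1\})=a_m,\qquad s(\{v,v+\omega\})=b_n,\qquad s(\{v,v+\omega^2\})=c_{1-n-m}.$$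
   Context: Let $\omega=e^{i\pi/3}$ and $HL=\{n+m\omega: n,m\in\mathbb Z\}\subset\mathbb C$. The set $E$ of edges consists of all unordered pairs $\{v,v+\omega^k\}$ with $v\in HL$, $k\in\mathbb Z/6$. (Vertices of $HL$ correspond to the hexagons of the dual honeycomb lattice, and elements of $E$ to the edges of the honeycomb lattice; the six edges $\{v,v+\omega^k\}$, $k=1,\dots,6$, are the consecutive edges of the hexagon around $v$.) The first equation of the system is the He–Schramm equation satisfied by the (purely imaginary) cross-ratios $s$ of hexagonal circle packings; the second one expresses that the packing is conformally symmetric. Labels: by the second equation a solution takes one value on each family of edges $\{v,v+1\}$ with $v=n+m\omega$ and $m$ fixed (called $a_m$), one value on each family $\{v,v+\omega\}$ with $n$ fixed (called $b_n$), and one value on each family $\{v,v+\omega^2\}$ with $n+m$ fixed (called $c_{1-n-m}$). Thus the values on the three pairs of opposite edges at a vertex are $a_i,b_j,c_k$ with $i+j+k=1$. *)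

(* Defs.v *)
From HB Require Import structures.
From mathcomp Require Import all_boot all_order all_algebra.
From mathcomp Require Import all_classical all_reals all_analysis.
From mathcomp Require Import complex.

Set Implicit Arguments.
Unset Strict Implicit.
Unset Printing Implicit Defensive.

Import Order.TTheory GRing.Theory Num.Theory.

Local Open Scope classical_set_scope.
Local Open Scope ring_scope.
Local Open Scope complex_scope.

Definition cis (R : realType) (t : R) : R[i] := cos t +i* sin t.

Definition omega (R : realType) : R[i] := cis (pi / 3).

Definition HL (R : realType) : set R[i] :=
  [set v | exists n m : int, v = n%:~R + m%:~R * omega R].
Arguments HL : clear implicits.

(* The exponent [k] is coerced to a natural number below 6; this is harmless
   since [omega R ^+ 6 = 1]. *)
Definition edge (R : realType) (v : R[i]) (k : 'Z_6) : set R[i] :=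
  [set v; v + omega R ^+ k].

Definition edges (R : realType) : set (set R[i]) :=
  [set e | exists v k, HL R v /\ e = edge v k].
Arguments edges : clear implicits.

Definition imaginary_axis (R : realType) : set R[i] := [set z | complex.Re z = 0].
Arguments imaginary_axis : clear implicits.

Definition edge_value (R : realType) (s : set R[i] -> R[i])
  (v : R[i]) (k : 'Z_6) : R[i] := s (edge v k).

Definition is_solution (R : realType) (s : set R[i] -> R[i]) : Prop :=
  forall (v : R[i]) (k : 'Z_6), HL R v ->
    let sv := edge_value s v in
    sv k + sv (k + 2) + sv (k + 4) + sv k * sv (k + 1) * sv (k + 2) = 0
    /\ sv k = sv (k + 3).

(* [tan x] is [sin x / cos x] with division by zero returning [0], so that
   finiteness of the tangent has to be stated separately. *)
Definition tan_finite (R : realType) (x : R) : Prop := cos x != 0.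

Definition itan (R : realType) (Delta phase : R) (n : int) : R[i] :=
  0 +i* tan (Delta * n%:~R + phase).

(* Main.v *)
(* The symmetry s_k = s_(k+3) makes s constant along the lines of the lattice,
   so s is given by real sequences a, b, c, and the first equation becomes
   a_i + b_j + c_k = a_i b_j c_k for i + j + k = 1. Since
   sin (x + y + z) = cos x cos y cos z (tan x + tan y + tan z - tan x tan y tan z),
   it says that A_i + B_j + C_k vanishes modulo pi, where A, B, C are the
   arctangents of a, b, c. Comparing the triples (i + 1, j, k) and (i, j + 1, k)
   shows that A_(i+1) - A_i = B_(j+1) - B_j modulo pi for all i and j, so that
   A, B and then C are arithmetic progressions modulo pi with a common
   difference. *)
Require Import Defs.
From HB Require Import structures.
From mathcomp Require Import all_boot all_order all_algebra.
From mathcomp Require Import all_classical all_reals all_analysis.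
From mathcomp Require Import complex.
From mathcomp Require Import ring lra.

Import Order.TTheory GRing.Theory Num.Theory.

Local Open Scope classical_set_scope.
Local Open Scope ring_scope.
Local Open Scope complex_scope.

Lemma sin_eq0D (R : realType) (x y : R) :
  sin x = 0 -> sin y = 0 -> sin (x + y) = 0.
Proof. by move=> x0 y0; rewrite sinD x0 y0 mul0r mulr0 addr0. Qed.

Lemma sin_eq0N (R : realType) (x : R) : sin x = 0 -> sin (- x) = 0.
Proof. by rewrite sinN => ->; rewrite oppr0. Qed.

Lemma sin_add3 (R : realType) (x y z : R) :
  cos x != 0 -> cos y != 0 -> cos z != 0 ->
  sin (x + y + z) = cos x * cos y * cos z *
    (tan x + tan y + tan z - tan x * tan y * tan z).
Proof.
move=> cx cy cz; rewrite !(sinD, cosD) /tan; field.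
by rewrite cx cy cz.
Qed.

Lemma tan_add3_eq (R : realType) (x y z : R) :
  cos x != 0 -> cos y != 0 -> cos z != 0 ->
  sin (x + y + z) = 0 <-> tan x + tan y + tan z = tan x * tan y * tan z.
Proof.
move=> cx cy cz; rewrite sin_add3 //; split=> [/eqP|->]; last by rewrite subrr mulr0.
by rewrite !mulf_eq0 (negbTE cx) (negbTE cy) (negbTE cz) /= subr_eq0 => /eqP.
Qed.

(** Writing [x = (x - y) + y], the sine and cosine of [x] are those of [y] times the same factor
    [cos (x - y)], which is nonzero because [cos x] is. *)
Lemma tan_congr (R : realType) (x y : R) :
  cos x != 0 -> sin (x - y) = 0 -> cos y != 0 /\ tan y = tan x.
Proof.
move=> cx sxy.
have ex : x = (x - y) + y by rewrite subrK.
have cxE : cos x = cos (x - y) * cos y by rewrite {1}ex cosD sxy mul0r subr0.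
have sxE : sin x = cos (x - y) * sin y by rewrite {1}ex sinD sxy mul0r add0r.
move: cx; rewrite cxE mulf_eq0 negb_or => /andP[c0 cy]; split=> //.
by rewrite /tan sxE cxE; field; rewrite c0 cy.
Qed.

Lemma int_shift_const (T : Type) (f : int -> T) :
  (forall n, f (n + 1) = f n) -> forall n, f n = f 0.
Proof.
move=> fS; elim/int_rect=> // n IH.
  by rewrite -IH -[RHS]fS -addn1 PoszD.
by rewrite -IH -[LHS]fS -addn1 PoszD opprD addrNK.
Qed.

(* [sin x = 0] stands for [x = 0] modulo [pi]. *)
Lemma sin_arith_progression (R : realType) (A B C : int -> R) :
  (forall n m, sin (A m + B n + C (1 - n - m)) = 0) ->
  let D := A 1 - A 0 in
  let g := - D - A 0 - B 0 in
  forall j, [/\ sin (A j - (D * j%:~R + A 0)) = 0,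
                sin (B j - (D * j%:~R + B 0)) = 0 &
                sin (C j - (D * j%:~R + g)) = 0].
Proof.
move=> H D g.
have AB i j : sin ((A (i + 1) - A i) - (B (j + 1) - B j)) = 0.
  have -> : (A (i + 1) - A i) - (B (j + 1) - B j) =
     (A (i + 1) + B j + C (1 - j - (i + 1))) +
     - (A i + B (j + 1) + C (1 - (j + 1) - i)).
    have -> : 1 - (j + 1) - i = 1 - j - (i + 1) by ring.
    by ring.
  by apply: sin_eq0D; [|apply: sin_eq0N]; apply: H.
have BD j : sin ((B (j + 1) - B j) - D) = 0.
  by rewrite -opprB; apply: sin_eq0N; have := AB 0 j; rewrite add0r.
have AD i : sin ((A (i + 1) - A i) - D) = 0.
  have -> : (A (i + 1) - A i) - D =
    ((A (i + 1) - A i) - (B (0 + 1) - B 0)) + ((B (0 + 1) - B 0) - D) by ring.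
  by apply: sin_eq0D.
have prog (F : int -> R) : (forall i, sin ((F (i + 1) - F i) - D) = 0) ->
    forall j, sin (F j - (D * j%:~R + F 0)) = 0.
  move=> FD; elim/int_rect => [|n IH|n IH].
  - by rewrite mulr0 add0r subrr sin0.
  - rewrite -addn1 PoszD.
    have -> : F (n%:Z + 1) - (D * (n%:Z + 1)%:~R + F 0) =
      (F n%:Z - (D * n%:~R + F 0)) + ((F (n%:Z + 1) - F n%:Z) - D).
      by rewrite intrD; ring.
    exact: sin_eq0D.
  - have nS : - n%:Z = - n.+1%:Z + 1 by rewrite -addn1 PoszD opprD addrNK.
    have -> : F (- n.+1%:Z) - (D * (- n.+1%:Z)%:~R + F 0) =
      (F (- n%:Z) - (D * (- n%:Z)%:~R + F 0)) +
      - ((F (- n.+1%:Z + 1) - F (- n.+1%:Z)) - D).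
      by rewrite -nS nS intrD; ring.
    by apply: sin_eq0D => //; apply: sin_eq0N.
have BP := prog B BD.
move=> j; split; [exact: prog|exact: prog|].
(* The hypothesis at [n = 1 - j], [m = 0] ties [C j] to [B (1 - j)], whose progression is already
   known. *)
have -> : C j - (D * j%:~R + g) =
  (A 0 + B (1 - j) + C (1 - (1 - j) - 0)) +
  - (B (1 - j) - (D * (1 - j)%:~R + B 0)).
  have -> : 1 - (1 - j) - 0 = j by ring.
  by rewrite /g intrB; ring.
by apply: sin_eq0D => //; apply: sin_eq0N.
Qed.

(** The triple angle formula turns [cos pi = -1] into [(c + 1) * (2 * c - 1) ^+ 2 = 0] for
    [c = cos (pi / 3)], and [c > 0] excludes the root [-1]. *)
Lemma cos_pi3 (R : realType) : cos (pi / 3) = 2^-1 :> R.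
Proof.
set x : R := pi / 3.
have x_gt0 : 0 < x by rewrite divr_gt0 // pi_gt0.
have xE : x + x + x = pi by rewrite /x; field.
have cx : 0 < cos x.
  by apply: cos_gt0_pihalf; rewrite (_ : pi = x + x + x) //; apply/andP; split; lra.
have := cospi R; rewrite -xE !(cosD, sinD) => e.
have s2 := cos2Dsin2 x.
have : (cos x + 1) * (2 * cos x - 1) ^+ 2 = 0.
  have s2c : sin x ^+ 2 * cos x = (1 - cos x ^+ 2) * cos x by rewrite -s2; ring.
  by lra.
move/eqP; rewrite mulf_eq0 gt_eqF ?addr_gt0 //= expf_eq0 /= => /eqP h.
by lra.
Qed.

Lemma omega_sqr (R : realType) : omega R ^+ 2 = omega R - 1.
Proof.
rewrite /omega /cis expr2; apply/eqP; rewrite eq_complex /= !subr0.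
have s2 := cos2Dsin2 (pi / 3 : R).
by rewrite cos_pi3 in s2 *; apply/andP; split; apply/eqP; nra.
Qed.

Lemma omega_exp3 (R : realType) : omega R ^+ 3 = - 1.
Proof. by rewrite exprS omega_sqr mulrBr mulr1 -expr2 omega_sqr; ring. Qed.

Lemma set2_shift (R : realType) (v w : R[i]) : [set v; v - w] = [set v - w; v - w + w].
Proof. by rewrite subrK setUC. Qed.

Section Hexagon.
Context {R : realType} (s : set R[i] -> R[i]).

(** The exponent is a plain natural number, not an element of ['Z_6], so that [exprD] applies to
    [k + 3]. *)
Definition spoke (v : R[i]) (k : nat) : R[i] := s [set v; v + omega R ^+ k].

(** Since [omega R ^+ 3 = - 1], opposite spokes at [v] are parallel edges at neighbouring vertices;
    the symmetry thus becomes invariance under a lattice translation. *)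
Lemma spokeD3 (v : R[i]) (k : nat) :
  spoke v (k + 3) = spoke (v - omega R ^+ k) k.
Proof. by rewrite /spoke exprD omega_exp3 mulrN1 set2_shift. Qed.

(** Once opposite spokes agree, indices matter only modulo 3. Both [k, k + 2, k + 4] and
    [k, k + 1, k + 2] run through all residues modulo 3, so the six equations reduce to one. *)
Lemma is_solutionP :
  is_solution s <->
  forall v, HL R v ->
    [/\ spoke v 0 = spoke v 3, spoke v 1 = spoke v 4, spoke v 2 = spoke v 5 &
        spoke v 0 + spoke v 1 + spoke v 2 +
          spoke v 0 * spoke v 1 * spoke v 2 = 0].
Proof.
split=> [sol v Hv|H v k Hv /=].
  have h (k : 'Z_6) := (sol v k Hv).2.
  have e0 : spoke v 0 = spoke v 3 := h 0.
  have e1 : spoke v 1 = spoke v 4 := h 1.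
  have e2 : spoke v 2 = spoke v 5 := h 2.
  split=> //.
  have := (sol v 0 Hv).1.
  change (spoke v 0 + spoke v 2 + spoke v 4 + spoke v 0 * spoke v 1 * spoke v 2 = 0
    -> spoke v 0 + spoke v 1 + spoke v 2 + spoke v 0 * spoke v 1 * spoke v 2 = 0).
  by rewrite -e1 => <-; ring.
have [e0 e1 e2 e] := H v Hv.
case: k => [[|[|[|[|[|[|//]]]]]] ?].
- change (spoke v 0 + spoke v 2 + spoke v 4 + spoke v 0 * spoke v 1 * spoke v 2 = 0 /\ spoke v 0 = spoke v 3).
  by rewrite -?e0 -?e1 -?e2 -e; split=> //; ring.
- change (spoke v 1 + spoke v 3 + spoke v 5 + spoke v 1 * spoke v 2 * spoke v 3 = 0 /\ spoke v 1 = spoke v 4).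
  by rewrite -?e0 -?e1 -?e2 -e; split=> //; ring.
- change (spoke v 2 + spoke v 4 + spoke v 0 + spoke v 2 * spoke v 3 * spoke v 4 = 0 /\ spoke v 2 = spoke v 5).
  by rewrite -?e0 -?e1 -?e2 -e; split=> //; ring.
- change (spoke v 3 + spoke v 5 + spoke v 1 + spoke v 3 * spoke v 4 * spoke v 5 = 0 /\ spoke v 3 = spoke v 0).
  by rewrite -?e0 -?e1 -?e2 -e; split=> //; ring.
- change (spoke v 4 + spoke v 0 + spoke v 2 + spoke v 4 * spoke v 5 * spoke v 0 = 0 /\ spoke v 4 = spoke v 1).
  by rewrite -?e0 -?e1 -?e2 -e; split=> //; ring.
- change (spoke v 5 + spoke v 1 + spoke v 3 + spoke v 5 * spoke v 0 * spoke v 1 = 0 /\ spoke v 5 = spoke v 2).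
  by rewrite -?e0 -?e1 -?e2 -e; split=> //; ring.
Qed.

End Hexagon.

(* A function on [edges R] is a function on sets of complex numbers of which
   only the values on [edges R] are used; [{fun A >-> B}] maps [A] into [B]. *)
Theorem theorem3p4 (R : realType) (s : {fun edges R >-> imaginary_axis R}) :
  is_solution s <->
  exists alpha beta gamma : R,
    let Delta := - alpha - beta - gamma in
    let a := itan Delta alpha in
    let b := itan Delta beta in
    let c := itan Delta gamma in
    (forall j : int,
       [/\ tan_finite (Delta * j%:~R + alpha),
           tan_finite (Delta * j%:~R + beta) &
           tan_finite (Delta * j%:~R + gamma)])
    /\ (forall n m : int,
          let v := n%:~R + m%:~R * omega R in
          [/\ s [set v; v + 1] = a m,
              s [set v; v + omega R] = b n &
              s [set v; v + omega R ^+ 2] = c (1 - n - m)]).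
Proof.
pose pt (n m : int) : R[i] := n%:~R + m%:~R * omega R.
have ptHL n m : HL R (pt n m) by exists n, m.
have ptB0 n m : pt n m - omega R ^+ 0 = pt (n - 1) m.
  by rewrite /pt intrB expr0; ring.
have ptB1 n m : pt n m - omega R ^+ 1 = pt n (m - 1).
  by rewrite /pt intrB expr1; ring.
(* As [omega R ^+ 2 = omega R - 1], this translation preserves [n + m]. *)
have ptB2 n m : pt n m - omega R ^+ 2 = pt (n + 1) (m - 1).
  by rewrite /pt omega_sqr intrB intrD; ring.
pose F k n m := spoke s (pt n m) k.
have F3 n m : F 3 n m = F 0 (n - 1) m by rewrite /F (spokeD3 s _ 0) ptB0.
have F4 n m : F 4 n m = F 1 n (m - 1) by rewrite /F (spokeD3 s _ 1) ptB1.
have F5 n m : F 5 n m = F 2 (n + 1) (m - 1) by rewrite /F (spokeD3 s _ 2) ptB2.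
rewrite is_solutionP; split.
- move=> sol.
  have solF n m : [/\ F 0 n m = F 3 n m, F 1 n m = F 4 n m, F 2 n m = F 5 n m &
      F 0 n m + F 1 n m + F 2 n m + F 0 n m * F 1 n m * F 2 n m = 0] :=
    sol _ (ptHL n m).
  (* Each family is read off at one representative edge; the family labelled [k] in [c] has
     [n + m = 1 - k] and is met at [n = 1 - k], [m = 0]. *)
  pose a m := complex.Im (F 0 0 m); pose b n := complex.Im (F 1 n 0).
  pose c k := complex.Im (F 2 (1 - k) 0).
  have ReF (k : 'Z_6) n m : complex.Re (F k n m) = 0.
    by apply: (@funS _ _ _ _ s); exists (pt n m), k.
  have Fa n m : F 0 n m = 0 +i* a m.
    rewrite (int_shift_const _ (F 0 ^~ m)) => [|i].
      by rewrite /a -(ReF 0 0 m); case: (F _ _ _).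
    have [-> _ _ _] := solF (i + 1) m.
    by rewrite F3 addrK.
  have Fb n m : F 1 n m = 0 +i* b n.
    rewrite (int_shift_const _ (F 1 n)) => [|i].
      by rewrite /b -(ReF 1 n 0); case: (F _ _ _).
    have [_ -> _ _] := solF n (i + 1).
    by rewrite F4 addrK.
  have Fc n m : F 2 n m = 0 +i* c (1 - n - m).
    (* Slide along the line of constant [n + m] down to second coordinate 0. *)
    have -> : F 2 n m = F 2 (n + m) 0.
      have := int_shift_const _ (fun i => F 2 (n + m - i) i).
      move=> /(_ _ m) /=; rewrite addrK subr0; apply=> i.
      have [_ _ -> _] := solF (n + m - (i + 1)) (i + 1).
      rewrite F5 addrK; congr (F 2 _ _); ring.
    rewrite /c; have -> : 1 - (1 - n - m) = n + m by ring.
    by rewrite -(ReF 2 (n + m) 0); case: (F _ _ _).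
  have cat x : cos (atan x) != 0 :> R.
    by rewrite gt_eqF // cos_gt0_pihalf // atan_gtNpi2 atan_ltpi2.
  have H n m : sin (atan (a m) + atan (b n) + atan (c (1 - n - m))) = 0.
    apply/tan_add3_eq => //; rewrite !atanK.
    have [_ _ _] := solF n m.
    (* The cube of the imaginary unit is its opposite, which moves the product to the other side
       with a plus sign. *)
    rewrite Fa Fb Fc => /(congr1 (@complex.Im R)) /=.
    lra.
  have := sin_arith_progression _ (atan \o a) (atan \o b) (atan \o c) H.
  rewrite /= => P.
  set D := atan (a 1) - atan (a 0) in P.
  (* The third phase is chosen so that [Delta] equals the common difference [D]. *)
  exists (atan (a 0)), (atan (b 0)), (- D - atan (a 0) - atan (b 0)) => /=.
  have -> : - atan (a 0) - atan (b 0) - (- D - atan (a 0) - atan (b 0)) = D by ring.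
  split=> [j|n m].
    by have [/tan_congr[]// ? _ /tan_congr[]// ? _ /tan_congr[]// ? _] := P j.
  split.
  + change (F 0 n m = itan D (atan (a 0)) m); rewrite Fa /itan.
    by have [/tan_congr[]// _ -> _ _] := P m; rewrite atanK.
  + change (F 1 n m = itan D (atan (b 0)) n); rewrite Fb /itan.
    by have [_ /tan_congr[]// _ -> _] := P n; rewrite atanK.
  + change (F 2 n m = itan D (- D - atan (a 0) - atan (b 0)) (1 - n - m)).
    rewrite Fc /itan.
    by have [_ _ /tan_congr[]// _ ->] := P (1 - n - m); rewrite atanK.
- move=> [al [be [ga [fin val]]]] _ [n [m ->]]; rewrite -/(pt n m).
  set D := - al - be - ga in fin val.
  have Fa i j : F 0 i j = itan D al j by have [] := val i j.
  have Fb i j : F 1 i j = itan D be i by have [] := val i j.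
  have Fc i j : F 2 i j = itan D ga (1 - i - j) by have [] := val i j.
  rewrite -/(F 0 n m) -/(F 1 n m) -/(F 2 n m) -/(F 3 n m) -/(F 4 n m) -/(F 5 n m).
  rewrite F3 F4 F5 !Fa !Fb !Fc; split=> //.
    by congr itan; ring.
  have [ca _ _] := fin m; have [_ cb _] := fin n; have [_ _ cc] := fin (1 - n - m).
  (* The indices sum to 1 and the phases to [- D], so the angles sum to exactly 0. *)
  have : sin ((D * m%:~R + al) + (D * n%:~R + be) + (D * (1 - n - m)%:~R + ga)) = 0.
    rewrite -[RHS]sin0; congr sin; rewrite !intrB /D; ring.
  move/(tan_add3_eq _ _ _ _ ca cb cc) => e.
  rewrite /itan; apply/eqP; rewrite eq_complex /=; apply/andP; split; apply/eqP; lra.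
Qed.
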